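(* Let $(X,d)$ be a metric space, $\varphi:X\to\mathbb{R}$ and $\varepsilon:X\to(0,+\infty)$ be continuous functions, and $A\subset X$ be a closed set. Then each locally Lipschitz function $g:A\to\mathbb{R}$ with $|g(a)-\varphi(a)|<\varepsilon(a)$ for every $a\in A$ can be extended to a locally Lipschitz function $f:X\to\mathbb{R}$ such that $|f(x)-\varphi(x)|<\varepsilon(x)$ for every $x\in X$.
   Context: A function $f:X\to\mathbb{R}$ on a metric space $(X,d)$ is Lipschitz if there exists $K\ge 0$ such that $|f(p)-f(q)|\le K\,d(p,q)$ for all $p,q\in X$; it is locally Lipschitz if each point of $X$ is contained in an open set $U\subset X$ such that the restriction of $f$ to $U$ is Lipschitz. The set $A$ carries the restricted metric. That $f$ extends $g$ means $f(a)=g(a)$ for every $a\in A$. *)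

(* Defs.v *)
From HB Require Import structures.
From mathcomp Require Import all_boot all_order all_algebra.
From mathcomp Require Import all_classical all_reals all_analysis.

Set Implicit Arguments.
Unset Strict Implicit.
Unset Printing Implicit Defensive.

Import Order.TTheory GRing.Theory Num.Theory.
Import numFieldNormedType.Exports.

Local Open Scope classical_set_scope.
Local Open Scope ring_scope.

(* The library equips [set_type A] with the induced pseudometric only. The
   instance below adds the restricted distance, so that the subset [A] of a
   metric space is a [metricType] whose topology is the induced one. *)
Section restricted_metric.
Context {R : realType} {X : metricType R} (A : set X).

Definition sub_mdist (a b : A) : R := mdist (set_val a) (set_val b).

Lemma sub_mdist_ge0 (a b : A) : 0 <= sub_mdist a b.
Proof. exact: mdist_ge0. Qed.

Lemma sub_mdist_positivity (a b : A) : sub_mdist a b = 0 -> a = b.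
Proof. by move=> /mdist_positivity; exact: val_inj. Qed.

Lemma sub_ballEmdist (a : A) (r : R) :
  ball a r = [set b | sub_mdist a b < r].
Proof.
rewrite /sub_mdist; apply/seteqP; split => b /=.
  by move=> ab; have : ball (set_val a) r (set_val b) by []; rewrite ballEmdist.
by move=> ab; suff : ball (set_val a) r (set_val b) by []; rewrite ballEmdist.
Qed.

HB.instance Definition _ := PseudoMetric_isMetric.Build R (set_type A)
  sub_mdist_ge0 sub_mdist_positivity sub_ballEmdist.

End restricted_metric.

(* The library's [lipschitz] requires a normed module as domain. *)
Definition lipschitz_fun (R : realType) (X : metricType R) (f : X -> R) :=
  exists2 K : R, 0 <= K & forall p q : X, `|f p - f q| <= K * mdist p q.

Definition locally_lipschitz (R : realType) (X : metricType R) (f : X -> R) :=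
  forall x : X, exists U : set X,
    [/\ open U, U x & lipschitz_fun (sigL U f)].

(* Main.v *)
(* An inf-convolution replaces partitions of unity.  Let [e <= eps] be continuous
   and positive, equal to [eps] on [A] and smaller off [A], and let [l <= u] be
   [g] on [A] and [phi -+ e] off [A].  Near every point there is a scale [s]
   with [l y - u z <= d(y,z) / s] and [|u| <= 1 / s]; the largest such scales,
   halved, form a positive 1-Lipschitz function [r] on [X].  Then
   [f x = inf {u y + 8 d(x,y) / r(y)^2 : d(x,y) < r y}] is locally Lipschitz and
   lies between [l] and [u]. *)

Require Import Defs.
From mathcomp Require Import all_boot all_order all_algebra.
From mathcomp Require Import all_classical all_reals all_analysis.
From mathcomp Require Import lra.

Set Implicit Arguments.
Unset Strict Implicit.
Unset Printing Implicit Defensive.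

Import Order.TTheory GRing.Theory Num.Theory.
Import numFieldNormedType.Exports.

Local Open Scope classical_set_scope.
Local Open Scope ring_scope.

Lemma locally_lipschitzP (R : realType) (X : metricType R) (f : X -> R) :
  locally_lipschitz f <->
  forall x, exists s K : R, [/\ 0 < s, 0 <= K &
    forall p q, mdist x p < s -> mdist x q < s ->
      `|f p - f q| <= K * mdist p q].
Proof.
split=> lf x.
- have [U [oU Ux [K K0 fK]]] := lf x.
  have /nbhs_ballP[s s0 sU] : nbhs x U by exact: open_nbhs_nbhs.
  rewrite ballEmdist in sU.
  exists s, K; split => // p q xp xq.
  exact: fK (SigSub (mem_set (sU p xp))) (SigSub (mem_set (sU q xq))).
- have [s [K [s0 K0 fK]]] := lf x.
  exists (ball x s)°; split; first exact: open_interior.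
    exact: nbhsx_ballx.
  exists K => // p q.
  have in_ball (z : set_type (ball x s)°) : mdist x (set_val z) < s.
    have : ball x s (set_val z) by apply: interior_subset; exact: set_valP.
    by move: (set_val z) => y; rewrite ballEmdist.
  exact: fK.
Qed.

Lemma near_mdistP (R : realType) (X : metricType R) (x : X) (P : X -> Prop) :
  (\forall y \near x, P y) <->
  exists2 s : R, 0 < s & forall y, mdist x y < s -> P y.
Proof.
split=> [/nbhs_ballP[s s0 sP]|[s s0 sP]].
  by exists s => // y xy; apply: sP; rewrite ballEmdist.
by apply/nbhs_ballP; exists s => // y; rewrite ballEmdist; exact: sP.
Qed.

(** Think of [D x s] as: the scale [s] is admissible at [x]. By [DS], moving the centre costs at
    most the distance moved, so the supremum of the admissible scales in [[0, 1]] is 1-Lipschitz.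
    That supremum need not be admissible itself; half of it lies below some admissible scale, hence
    is admissible. *)
Lemma lipschitz_radius (R : realType) (X : metricType R) (D : X -> R -> Prop)
    (D0 : forall x, D x 0)
    (DS : forall x y (s t : R), 0 <= t -> t + mdist x y <= s -> D x s -> D y t) :
  exists r : X -> R, [/\ forall x, 0 <= r x <= 1,
    forall x y, r x <= r y + mdist x y,
    forall x, D x (r x) &
    forall x (s : R), 0 < s -> D x s -> 0 < r x].
Proof.
pose E x := [set s : R | 0 <= s <= 1 /\ D x s].
have E0 x : E x 0 by split => //; rewrite lexx ler01.
have ubE x : has_ubound (E x) by exists 1 => s [/andP[]].
have supE x : has_sup (E x) by split => //; exists 0.
have sup_ge x s : E x s -> s <= sup (E x) by move=> Es; apply: ub_le_sup.
have sup01 x : 0 <= sup (E x) <= 1.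
  rewrite sup_ge//=; apply: ge_sup; first by exists 0.
  by move=> s [/andP[]].
exists (fun x => sup (E x) / 2); split => [x|x y|x|x s s0 Ds].
- by have := sup01 x; lra.
- have := mdist_ge0 x y; have := sup01 y => y01 d0.
  suff : sup (E x) <= sup (E y) + mdist x y by lra.
  apply: ge_sup; first by exists 0.
  (* [DS] transports [s] to [y] only if [s - mdist x y] is nonnegative; otherwise [0 <= sup (E y)]
     suffices. *)
  move=> s [s01 Ds]; have [sd|sd] := leP s (mdist x y); first by lra.
  suff : s - mdist x y <= sup (E y) by lra.
  apply: sup_ge; split; first by lra.
  by apply: (DS x y s) => //; lra.
- have [s0|s0] := leP (sup (E x)) 0.
    by have -> : sup (E x) / 2 = 0 by have := sup01 x; lra.
  have [//|s [s01 Ds] lts] := sup_adherent (_ : 0 < sup (E x) / 2) (supE x).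
    by lra.
  by apply: (DS x x s) => //; rewrite ?mdistxx; lra.
- have [s1|s1] := leP s 1.
    by have : s <= sup (E x) by [apply: sup_ge; split => //; lra]; lra.
  suff : 1 <= sup (E x) by lra.
  apply: sup_ge; split; first by lra.
  by apply: (DS x x s) => //; rewrite ?mdistxx; lra.
Qed.

(** A locally Lipschitz [f] between [l] and [u] satisfies [l y - u z <= f y - f z <= K d(y,z)] near
    each point, so the first bound is forced. The second, local boundedness of [u], keeps
    near-minimisers of the infimum close. *)
Lemma locally_lipschitz_insertion (R : realType) (X : metricType R)
    (l u : X -> R)
    (lu : forall x, exists s : R, 0 < s /\ forall y z,
      mdist x y < s -> mdist x z < s ->
      s * (l y - u z) <= mdist y z /\ s * `|u z| <= 1) :
  exists f : X -> R, locally_lipschitz f /\ forall x, l x <= f x <= u x.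
Proof.
(* Multiplying by [s] instead of dividing makes [s = 0] admissible, as [lipschitz_radius]
   requires. *)
pose D (x : X) (s : R) := forall y z, mdist x y < s -> mdist x z < s ->
  s * (l y - u z) <= mdist y z /\ s * `|u z| <= 1.
have D0 x : D x 0 by move=> y z; rewrite !mul0r mdist_ge0 ler01.
have DS x y (s t : R) : 0 <= t -> t + mdist x y <= s -> D x s -> D y t.
  move=> t0 ts Ds p q yp yq; have dxy := mdist_ge0 x y.
  have [||luq uq] := Ds p q.
  - by have := metric_triangle x y p; lra.
  - by have := metric_triangle x y q; lra.
  have := mdist_ge0 p q; have uq0 := normr_ge0 (u q).
  split; last by nra.
  by have [lu0|lu0] := leP (l p - u q) 0; nra.
have [r [r01 r_lip Dr r_pos]] := lipschitz_radius D0 DS.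
have r0 x : 0 < r x by have [s [s0 Ds]] := lu x; exact: r_pos Ds.
pose T x y := u y + 8 * (mdist x y / r y ^+ 2).
pose E x := [set T x y | y in [set y | mdist x y < r y]].
pose f x := inf (E x).
have mdistE x y : mdist x y = mdist x y / r y ^+ 2 * r y ^+ 2.
  by rewrite divfK// expf_neq0// gt_eqF.
have Tq x y : 0 <= mdist x y / r y ^+ 2.
  by rewrite divr_ge0 ?mdist_ge0// exprn_ge0// ltW.
(* Here [l x - u y <= d(x,y) / r y <= d(x,y) / r(y)^2], because [r y <= 1]. *)
have lT x y : mdist x y < r y -> l x <= T x y.
  move=> xy; have := r0 y; have := r01 y; have := Tq x y; have := mdistE x y.
  have yx : mdist y x < r y by rewrite metric_sym.
  have [|+ _] := Dr y x y yx; rewrite ?mdistxx//.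
  rewrite /T; move: (_ / _) => q.
  move=> h1 h2 q0 /andP[_ r1] ry.
  have : l x - u y <= q * r y by rewrite -(ler_pM2l ry); lra.
  by nra.
have lE x : lbound (E x) (l x) by move=> _ [y /= xy <-]; exact: lT.
have fT x y : mdist x y < r y -> f x <= T x y.
  by move=> xy; apply: ge_inf; [exists (l x) | exists y].
have fu x : f x <= u x.
  by rewrite (le_trans (fT x x _))// /T mdistxx// mul0r mulr0 addr0.
have nE x : E x !=set0 by exists (T x x), x; rewrite //= mdistxx.
exists f; split => [|x]; last by rewrite fu andbT; exact: lb_le_inf.
(* Near-minimisers [y] satisfy [d(x,y) < r y / 2] because [|u| <= 1 / r y] on
   the ball of radius [r y]; so [y] still competes at points near [x]. *)
have minimiser x e : 0 < e -> exists y, mdist x y < r y / 2 /\ T x y < f x + e.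
  move=> e0; have m0 : 0 < Num.min e 1 by rewrite lt_min e0 ltr01.
  have [|_ [y /= xy <-] Ty] := inf_adherent m0 (_ : has_inf (E x)).
    by split => //; exists (l x).
  have [me m1] : Num.min e 1 <= e /\ Num.min e 1 <= 1.
    by split; rewrite ge_min lexx ?orbT.
  exists y; split; last by move: Ty; rewrite -/(f x); lra.
  rewrite ltNge; apply/negP => yfar.
  have yy : mdist y y < r y by rewrite mdistxx.
  have yx : mdist y x < r y by rewrite metric_sym.
  have [_ ux] := Dr y y x yy yx; have [_ uy] := Dr y y y yy yy.
  have := ler_norm (u x); have := lerNnormlW (lexx `|u y|) => uy' ux'.
  have := fu x; have := r0 y; have := r01 y; have := Tq x y.
  have := mdistE x y; move: Ty yfar; rewrite -/(f x) /T.
  move: (mdist x y) (_ / _) => d q *.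
  (* If [d(x,y) >= r y / 2], the penalty [8 * q] is at least [4 / r y]. But [T x y < u x + 1] bounds
     it by [2 / r y + 1 <= 3 / r y]: this is what the factor 8 and the cap of the slack at 1 are
     for. *)
  have : 1 / 2 <= q * r y by nra.
  have : r y * (u x - u y) <= 2 by nra.
  by nra.
apply/locally_lipschitzP => x0.
have rx0 := r0 x0.
exists (r x0 / 8), (32 / r x0 ^+ 2); split; first by lra.
  by rewrite divr_ge0// exprn_ge0// ltW.
(* A near-minimiser [y] for [p] has [7/8 * r x0 <= r p <= 3/2 * r y], so [r x0 / 2 <= r y]. Then
   [d(q,y) < r x0 / 4 + r y / 2 <= r y], so [y] competes at [q], and the penalty has slope
   [8 / r(y)^2 <= 32 / r(x0)^2]. *)
have half p q : mdist x0 p < r x0 / 8 -> mdist x0 q < r x0 / 8 ->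
    f q - f p <= 32 / r x0 ^+ 2 * mdist p q.
  move=> xp xq; rewrite lerBlDl; apply/ler_addgt0Pr => e e0.
  have [y [py Ty]] := minimiser p e e0.
  have := r_lip x0 p; have := r_lip p y; have := metric_triangle p x0 q.
  have := metric_triangle q p y.
  rewrite (metric_sym p x0) (metric_sym q p) => tri1 tri2 rl1 rl2.
  have ry : r x0 / 2 <= r y by lra.
  have /fT fqT : mdist q y < r y by lra.
  suff : T q y <= T p y + 32 / r x0 ^+ 2 * mdist p q by lra.
  rewrite /T.
  have : mdist q y / r y ^+ 2 - mdist p y / r y ^+ 2
     <= 4 / r x0 ^+ 2 * mdist p q; last by lra.
  have iry : 0 <= (r y ^+ 2)^-1 <= 4 / r x0 ^+ 2.
    rewrite invr_ge0 exprn_ge0 ?(ltW (r0 y))//=.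
    rewrite ler_pdivlMr ?exprn_gt0// mulrC ler_pdivrMr ?exprn_gt0//.
    by nra.
  have := mdist_ge0 p q; rewrite -mulrBl; move: iry.
  by move: (_^-1) (4 / _) => i c; nra.
move=> p q xp xq; rewrite ler_norml; apply/andP; split; last first.
  by rewrite (metric_sym p q); exact: half.
by have := half p q xp xq; lra.
Qed.

(** Insertion yields only weak inequalities; shrinking the tube off [A] makes them strict there. The
    shrinking factor uses a continuous [r] vanishing exactly on [A], namely half of
    [min(1, d(x,A))]; the cap at 1 also covers empty [A]. *)
Lemma strict_tube (R : realType) (X : metricType R) (eps : X -> R)
    (A : set X) (eps_cont : continuous eps) (eps_gt0 : forall x : X, 0 < eps x)
    (A_closed : closed A) :
  exists e : X -> R, [/\ continuous e, forall x, 0 < e x,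
    forall x, A x -> e x = eps x & forall x, ~ A x -> e x < eps x].
Proof.
pose D (x : X) (s : R) := forall y, mdist x y < s -> ~ A y.
have D0 x : D x 0 by move=> y; rewrite ltNge mdist_ge0.
have DS x y (s t : R) : 0 <= t -> t + mdist x y <= s -> D x s -> D y t.
  move=> _ ts Ds z yz; apply: Ds.
  by rewrite (le_lt_trans (metric_triangle x y z))//; lra.
have [r [r01 r_lip Dr r_pos]] := lipschitz_radius D0 DS.
have rA x : A x -> r x = 0.
  move=> Ax; apply/eqP; rewrite eq_le; case/andP: (r01 x) => -> _.
  rewrite andbT leNgt; apply/negP => rx0.
  by apply: (Dr x x) => //; rewrite mdistxx.
have rNA x : ~ A x -> 0 < r x.
  move=> NAx; have : nbhs x (~` A).
    by apply: open_nbhs_nbhs; split => //; exact: closed_openC.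
  by move=> /near_mdistP[s s0 sA]; apply: (r_pos x s s0).
have r_cont : continuous r.
  move=> x; apply/cvgrPdist_lt => d d0; apply/near_mdistP; exists d => // y xy.
  have := r_lip x y; have := r_lip y x; rewrite (metric_sym y x) => ? ?.
  by rewrite ltr_norml; apply/andP; split; lra.
exists (fun x => eps x * (1 - r x / 2)); split => [x|x|x /rA ->|x /rNA rx].
- apply: cvgM; first exact: eps_cont.
  apply: cvgB; first exact: cvg_cst.
  by apply: cvgMl; exact: r_cont.
- by rewrite mulr_gt0//; have := r01 x; lra.
- by rewrite mul0r subr0 mulr1.
- by have := eps_gt0 x; have := r01 x; nra.
Qed.

Theorem theorem5p2 (R : realType) (X : metricType R) (phi eps : X -> R)
    (A : set X) (phi_cont : continuous phi) (eps_cont : continuous eps)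
    (eps_gt0 : forall x : X, 0 < eps x) (A_closed : closed A)
    (g : A -> R) (g_lip : locally_lipschitz g)
    (g_phi : forall a : A, `|g a - phi (set_val a)| < eps (set_val a)) :
  exists f : X -> R,
    [/\ locally_lipschitz f,
        forall a : A, f (set_val a) = g a
      & forall x : X, `|f x - phi x| < eps x].
Proof.
have [e [e_cont e_gt0 e_in e_out]] := strict_tube eps_cont eps_gt0 A_closed.
pose G := valL_ 0 g.
have GE (a : A) : G (set_val a) = g a by exact: (congr1 (@^~ a) (valLK 0 g)).
have G_phi x : A x -> `|G x - phi x| < e x.
  move=> Ax; rewrite e_in//.
  by have := g_phi (SigSub (mem_set Ax)); rewrite -GE.
have G_lip x : A x -> exists s K : R, [/\ 0 < s, 0 <= K & forall p q,
    A p -> A q -> mdist x p < s -> mdist x q < s ->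
    `|G p - G q| <= K * mdist p q].
  move=> Ax; have /locally_lipschitzP/(_ (SigSub (mem_set Ax))) := g_lip.
  move=> [s [K [s0 K0 gK]]]; exists s, K; split => // p q Ap Aq xp xq.
  have := gK (SigSub (mem_set Ap)) (SigSub (mem_set Aq)) xp xq.
  by rewrite -!GE.
pose l x := if x \in A then G x else phi x - e x.
pose u x := if x \in A then G x else phi x + e x.
(* This treats points on and off [A] uniformly: [c] is [G x0] on [A]. Off [A] it is [phi x0], and a
   ball missing [A] makes the conditions on [G] vacuous. *)
have center x0 : exists c s K : R, [/\ 0 < s, 0 <= K,
    `|c - phi x0| < e x0,
    forall y, A y -> mdist x0 y < s -> `|G y - c| <= K * mdist x0 y &
    forall y z, A y -> A z -> mdist x0 y < s -> mdist x0 z < s ->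
      `|G y - G z| <= K * mdist y z].
  have [Ax|NAx] := pselect (A x0).
    have [s [K [s0 K0 GK]]] := G_lip x0 Ax.
    exists (G x0), s, K; split => //; first exact: G_phi.
    move=> y Ay xy; rewrite metric_sym; apply: GK => //.
    by rewrite mdistxx.
  have : nbhs x0 (~` A).
    by apply: open_nbhs_nbhs; split => //; exact: closed_openC.
  move=> /near_mdistP[s s0 sA].
  by exists (phi x0), s, 0; split; rewrite ?subrr ?normr0// => y;
    [move=> Ay /sA | move=> z Ay _ /sA].
have lu x0 : exists s : R, 0 < s /\ forall y z,
    mdist x0 y < s -> mdist x0 z < s ->
    s * (l y - u z) <= mdist y z /\ s * `|u z| <= 1.
  have [c [s [K [s0 K0 c_phi Gc GK]]]] := center x0.
  (* In the mixed cases [G], [phi] and [e] each err by at most [h], and [3 * h] stays within the gap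
     between [c] and the edge of the tube. The cap at 1 accounts for the [+ 2] in [M]. *)
  pose h := Num.min 1 ((e x0 - `|c - phi x0|) / 4).
  have h_gt0 : 0 < h by rewrite lt_min ltr01/= divr_gt0// subr_gt0.
  have [h1 h2] : h <= 1 /\ h <= (e x0 - `|c - phi x0|) / 4.
    by split; rewrite ge_min lexx ?orbT.
  have [s1 s1_gt0 near1] : exists2 s1 : R, 0 < s1 & forall y, mdist x0 y < s1 ->
      `|phi x0 - phi y| < h /\ `|e x0 - e y| < h.
    apply/near_mdistP; near=> y; split; near: y.
      by have /cvgrPdist_lt := phi_cont x0; exact.
    by have /cvgrPdist_lt := e_cont x0; exact.
  pose M := `|phi x0| + e x0 + 2.
  have M_gt0 : 0 < M by rewrite addr_gt0// ltr_wpDl.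
  (* The third bound gives [K * t <= h], so [G] stays within [h] of [c]; the last gives both
     [t * K <= 1] and [t * M <= 1]. *)
  pose t := Num.min (Num.min s s1) (Num.min (h / (K + 1)) (1 / (K + M + 1))).
  have KM_gt0 : 0 < K + M + 1 by lra.
  have K1_gt0 : 0 < K + 1 by lra.
  have t_gt0 : 0 < t by rewrite !lt_min s0 s1_gt0 !divr_gt0.
  have : t <= t by [].
  rewrite {2}/t !le_min => /andP[/andP[ts ts1] /andP[]].
  rewrite !ler_pdivlMr// => tK tKM.
  exists t; split => // y z xy xz.
  have [] := near1 y (lt_le_trans xy ts1).
  have [] := near1 z (lt_le_trans xz ts1).
  rewrite !ltr_norml => /andP[pz1 pz2] /andP[ez1 ez2] /andP[py1 py2].
  move=> /andP[ey1 ey2].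
  have Gh w : A w -> mdist x0 w < t -> `|G w - c| <= h.
    move=> Aw xw; apply: le_trans (Gc w Aw (lt_le_trans xw ts)) _.
    have := mdist_ge0 x0 w; nra.
  have uM : `|u z| <= M.
    have z1 := lerNnormlW (lexx `|phi x0|).
    have z2 := ler_norm (phi x0).
    rewrite /u /M; case: ifPn => [/set_mem/G_phi|_].
      by rewrite ltr_norml ler_norml => /andP[? ?]; apply/andP; split; lra.
    have := e_gt0 z.
    by rewrite ler_norml => ?; apply/andP; split; lra.
  split; last by have := normr_ge0 (u z); nra.
  have dyz := mdist_ge0 y z.
  have [c1 c2] : c - phi x0 <= `|c - phi x0| /\ - `|c - phi x0| <= c - phi x0.
    by split; [exact: ler_norm | exact: lerNnormlW].
  (* Only when [y] and [z] both lie in [A] can [l y] exceed [u z]; there the Lipschitz bound on [G]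
     is used. *)
  have le0 : l y <= u z -> t * (l y - u z) <= mdist y z by move=> ?; nra.
  move: le0; rewrite /l /u.
  case: ifPn => [/set_mem Ay|_]; case: ifPn => [/set_mem Az|_] le0.
  - have := GK y z Ay Az (lt_le_trans xy ts) (lt_le_trans xz ts).
    rewrite ler_norml => /andP[_ Gyz].
    have : t * (G y - G z) <= t * (K * mdist y z) by rewrite ler_pM2l.
    by nra.
  - by apply: le0; have := Gh y Ay xy; rewrite ler_norml => /andP[? ?]; lra.
  - by apply: le0; have := Gh z Az xz; rewrite ler_norml => /andP[? ?]; lra.
  - by apply: le0; lra.
have [f [f_lip luf]] := locally_lipschitz_insertion lu.
have fG x : A x -> f x = G x.
  move=> Ax; apply/eqP; rewrite eq_le andbC.
  by have := luf x; rewrite /l /u mem_set.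
exists f; split => [//|a|x]; first by rewrite -GE fG//; exact: set_valP.
have [Ax|NAx] := pselect (A x).
  by rewrite fG// -e_in//; exact: G_phi.
have /andP[] := luf x; rewrite /l /u memNset// => ? ?.
by have := e_out x NAx; rewrite ltr_norml => ?; apply/andP; split; lra.
Unshelve. all: by end_near.
Qed.
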